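(* Let $a,b,c,d\in\mathbb{R}$, let $p,q\in\mathbb{R}[x,y]$ be polynomials with $o(p)>1$ and $o(q)>1$, and let $\Phi:\mathbb{R}^2\to\mathbb{R}^2$, $\Phi(x,y) = (ax+by+p(x,y),\, cx+dy+q(x,y))$, be a jacobian map. Suppose that at least one of the following holds: (i) $\max\{d(p),d(q)\} < o(p)+o(q)-1$; (ii) both $p$ and $q$ are even polynomials; (iii) $p$ is odd, $q$ is even, and $(p,q)$ satisfies the gap condition; (iv) $(p,q)$ satisfies the symmetric gap condition. Then $\Phi$ is globally invertible.
   Context: All polynomials have real coefficients. For a polynomial $P$, $d(P)$ denotes its (total) degree and $o(P)$ its order, i.e. the lowest total degree of a monomial occurring in $P$ with nonzero coefficient; for the zero polynomial, $d(0)=-\infty$ and $o(0)=+\infty$. (The symbol $d$ without argument in the claim is a real coefficient.) So $o(P)>1$ means that $P$ has no constant and no degree-one terms. A polynomial map $\Phi:\mathbb{R}^2\to\mathbb{R}^2$ is called a jacobian map if the determinant of its Jacobian matrix is a non-zero constant. Globally invertible means that $\Phi$ is a bijection of $\mathbb{R}^2$ onto $\mathbb{R}^2$. A polynomial is even if it is a sum of monomials of even total degree, and odd if it is a sum of monomials of odd total degree. A non-negative integer is a gap of $P$ if it is the difference of the (total) degrees of two distinct monomials occurring in $P$; $G(P)$ denotes the set of all gaps of $P$ (e.g. $P=x^3+y^3+x^2y^2+y^7$ has $G(P)=\{0,1,3,4\}$); if $P$ has exactly one monomial (or is zero), $G(P)=\emptyset$. The ordered couple $(P,Q)$ satisfies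 the gap condition if for every monomial $M$ occurring in $P$ one has $d(M)-1\notin G(Q)$. The couple $(P,Q)$ satisfies the symmetric gap condition if both $(P,Q)$ and $(Q,P)$ satisfy the gap condition. *)

(* Defs.v *)
From HB Require Import structures.
From mathcomp Require Import all_boot all_order all_algebra.
From mathcomp Require Import mpoly.
From mathcomp Require Import constructive_ereal reals.

Set Implicit Arguments.
Unset Strict Implicit.
Unset Printing Implicit Defensive.

Import Order.TTheory GRing.Theory Num.Theory.

Local Open Scope ring_scope.

Section PolynomialDegrees.
Variables (R : realType) (n : nat).
Implicit Types P Q : {mpoly R[n]}.

(* [msupp P] lists the monomials occurring in P with nonzero coefficient, and
   [mdeg] is the total degree. The neutral elements of the two big operators
   encode the conventions d(0) = -oo and o(0) = +oo. *)
Definition mpoly_degree P : \bar int :=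
  \big[maxe/-oo%E]_(m <- msupp P) ((mdeg m)%:Z)%:E.

Definition mpoly_order P : \bar int :=
  \big[mine/+oo%E]_(m <- msupp P) ((mdeg m)%:Z)%:E.

Definition even_mpoly P : Prop := forall m, m \in msupp P -> ~~ odd (mdeg m).

Definition odd_mpoly P : Prop := forall m, m \in msupp P -> odd (mdeg m).

(* The two monomials must differ, but may have the same degree: 0 is a gap as
   soon as two distinct monomials of P share their degree. *)
Definition is_gap P (g : nat) : Prop :=
  exists m1 m2, [/\ m1 \in msupp P, m2 \in msupp P, m1 != m2
                  & mdeg m1 = (mdeg m2 + g)%N].

(* [mdeg m = g.+1] avoids truncated subtraction in "d(m) - 1 is not a gap":
   for a constant monomial d(m) - 1 is negative, hence never a gap. *)
Definition gap_condition P Q : Prop :=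
  forall m g, m \in msupp P -> mdeg m = g.+1 -> ~ is_gap Q g.

Definition symmetric_gap_condition P Q : Prop :=
  gap_condition P Q /\ gap_condition Q P.

End PolynomialDegrees.

Section PolynomialMaps.
Variables (R : realType) (n : nat).
Implicit Type F : n.-tuple {mpoly R[n]}.

Definition polymap F (v : 'rV[R]_n) : 'rV[R]_n :=
  \row_i (tnth F i).@[fun j => v 0 j].

Definition jacobian_matrix F : 'M[{mpoly R[n]}]_n :=
  \matrix_(i, j) (tnth F i)^`M(j).

Definition jacobian_map F : Prop :=
  exists2 k : R, k != 0 & \det (jacobian_matrix F) = k%:MP.

End PolynomialMaps.

(* Main.v *)
Require Import Defs.
From mathcomp Require Import all_boot all_order all_algebra.
From mathcomp Require Import mpoly.
From mathcomp Require Import constructive_ereal reals.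
From mathcomp Require Import boolp ring lra zify.

Set Implicit Arguments.
Unset Strict Implicit.
Unset Printing Implicit Defensive.

Import Order.TTheory GRing.Theory Num.Theory.

Local Open Scope ring_scope.

(** Write [L = d p_x - c p_y + a q_y - b q_x] and [J = p_x q_y - p_y q_x]. The
    Jacobian determinant is [(a d - b c) + L + J]. Since [p] and [q] have order
    at least 2, neither [L] nor [J] has a constant term, so that
    [a d - b c] is the nonzero constant of the hypothesis and [L + J = 0]. A
    monomial of [L] has degree [d(M) - 1] for a monomial [M] of [p] or [q], a
    monomial of [J] has degree [d(M1) + d(M2) - 2] for monomials [M1] of [p]
    and [M2] of [q], and each of the four alternatives makes these degrees
    different ([degrees_separated]). Hence [L = 0] and [J = 0]
    ([jacobian_split]).

    Composing with the inverse of the linear part turns the map into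
    [id + H], [H = (P, Q)], and the two equations say that the Jacobian matrix
    of [H] has zero trace and zero determinant, that is, is nilpotent. The
    claim is then that [H (z + t H z) = H z] for all [z] and [t]
    ([nilpotent_shift]): with [t = 1] and [t = -1] it shows that [id - H] is
    the inverse of [id + H].

    This last identity has a geometric proof. Eliminating [Q] shows that the
    level curves of [P] have zero curvature ([level_curvature0]), so [P] is
    constant on the whole tangent line to its level curve at every noncritical
    point ([level_line]). Two of these lines that are not parallel meet, which
    forces equal values of [P]; were they not all parallel, [P] would be
    constant. So the kernel of the Jacobian matrix of [H] contains a fixed
    direction ([constant_kernel]). As the trace is zero, the component of [H]
    across that direction has zero gradient; it vanishes at the origin, hence
    everywhere. So [H] points in a direction along which it is constant. *)

(** * Univariate polynomials *)

Lemma poly_fun_eq0 (R : numDomainType) (f : {poly R}) :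
  (forall t, f.[t] = 0) -> f = 0.
Proof.
move=> f0; apply/eqP/negPn/negP => nz_f.
have := @max_poly_roots _ f [seq i%:R | i <- iota 0 (size f)] nz_f.
rewrite size_map size_iota ltnn => roots_lt; apply/notF/roots_lt; last first.
  by rewrite map_inj_uniq ?iota_uniq // => i j /eqP; rewrite eqr_nat => /eqP.
by apply/allP => t _; rewrite /root f0.
Qed.

(** Uniqueness for a linear differential equation, read off the order of
    vanishing at 0: if [f] vanished there to a finite order [m > 0], then
    [u * f^`()] would vanish to the order [m - 1] only, and [f * s] to the
    order [m] at least. *)
Lemma poly_lin_ode_eq0 (R : numDomainType) (f u s : {poly R}) :
  f.[0] = 0 -> u.[0] != 0 -> u * f^`() = f * s -> f = 0.
Proof.
move=> f0 u0 ode; apply/eqP/negPn/negP => nz_f.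
have [[|m] [g]] := multiplicity_XsubC f 0; rewrite nz_f subr0 /= => g0 fE.
  by move: g0; rewrite -(mulr1 g) -fE /root f0 eqxx.
have X0 : ('X^m : {poly R}) != 0 by rewrite monic_neq0 ?monicXn.
have regroup (Y X h k : {poly R}) :
    u * (h * (X * Y) + g * (Y * k)) = g * (X * Y) * s ->
  Y * (u * (h * X + g * k)) = Y * (g * X * s).
  by move=> eq; transitivity (g * (X * Y) * s); [rewrite -eq|]; ring.
have : u * (g^`() * 'X + g * m.+1%:R) = g * 'X * s.
  apply/(mulfI X0)/regroup.
  by rewrite -exprS mulr_natr -(derivXn _ m.+1) -derivM -fE ode.
move/(congr1 (fun h => h.[0])); rewrite mulr_natr !(hornerE, hornerMn).
by move/eqP; rewrite mulf_eq0 mulrn_eq0 (negPf u0) /=; apply/negP.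
Qed.

(** * Restriction of a polynomial to a line *)

Section Lines.
Variables (R : numDomainType) (n : nat).
Implicit Types (P Q : {mpoly R[n]}) (z w : 'I_n -> R).

Definition on_line z w P : {poly R} :=
  mmap (@polyC R) (fun i => (z i)%:P + w i *: 'X) P.

Lemma horner_on_line z w P t :
  (on_line z w P).[t] = P.@[fun i => z i + t * w i].
Proof.
rewrite /on_line; elim/mpolyind: P => [|c m P _ _ IH].
  by rewrite mmap0 meval0 horner0.
rewrite mmapD mevalD hornerD IH; congr (_ + _).
rewrite mmapZ mmapX mevalZ mevalX hornerM hornerC /mmap1 horner_prod.
congr (_ * _); apply: eq_bigr => i _.
by rewrite horner_exp hornerD hornerC hornerZ hornerX mulrC.
Qed.

Lemma on_lineM z w P Q : on_line z w (P * Q) = on_line z w P * on_line z w Q.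
Proof. exact: (rmorphM (mmap (@polyC R) _)). Qed.

(** The chain rule: both sides are derivations along the restriction morphism,
    so it is enough to compare them on the variables. *)
Lemma deriv_on_line z w P :
  (on_line z w P)^`() = \sum_i w i *: on_line z w P^`M(i).
Proof.
pose chain Q := (on_line z w Q)^`() = \sum_i w i *: on_line z w Q^`M(i).
have chainM Q1 Q2 : chain Q1 -> chain Q2 -> chain (Q1 * Q2).
  rewrite /chain on_lineM derivM => -> ->.
  rewrite mulr_suml mulr_sumr -big_split; apply: eq_bigr => i _ /=.
  rewrite mderivM /on_line mmapD -!/(on_line _ _ _) !on_lineM.
  by rewrite scalerDr -scalerAl -scalerAr.
have chain1 : chain 1.
  rewrite /chain /on_line rmorph1 derivC big1 // => i _.
  by rewrite mderivC mmap0 scaler0.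
rewrite -/(chain P); elim/mpolyind: P => [|c m P _ _ IH].
  rewrite /chain /on_line mmap0 deriv0 big1 // => i _.
  by rewrite mderiv0 mmap0 scaler0.
have chainX : chain 'X_[m].
  rewrite mpolyXE_id; elim/big_ind: _ => // j _.
  elim: (m j) => [|k IHk]; rewrite ?expr0 ?exprS //; apply: chainM => //.
  rewrite /chain /on_line mmapX mmap1U derivD derivC add0r derivZ derivX.
  rewrite (bigD1 j) //= big1 => [|i ij].
    rewrite addr0 mderivX mnm1E eqxx.
    have -> : (U_(j) - U_(j) = 0 :> 'X_{1..n})%MM.
      by apply/mnmP => l; rewrite mnmBE subnn mnm0E.
    by rewrite mmapZ mmapX mmap11 mulr1 ?rmorph1 alg_polyC.
  rewrite mderivX mnm1E (negPf (_ : j != i)) 1?eq_sym // scale0r.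
  by rewrite mmap0 scaler0.
rewrite /chain /on_line mmapD mmapZ derivD derivM derivC mul0r add0r.
rewrite -!/(on_line _ _ _) chainX IH mulr_sumr -big_split.
apply: eq_bigr => i _ /=.
by rewrite mderivD mderivZ /on_line mmapD mmapZ scalerDr scalerAr.
Qed.

(** On the line joining [v] to [z] the product of the restrictions is 0 in an
    integral domain, and the second factor is not 0, since it takes the value
    [Q.@[z]]. *)
Lemma meval_mulI P Q z :
    (forall v, P.@[v] * Q.@[v] = 0) -> Q.@[z] != 0 ->
  forall v, P.@[v] = 0.
Proof.
move=> PQ0 Qz v; pose w i := v i - z i.
have /eqP : on_line z w P * on_line z w Q = 0.
  by apply: poly_fun_eq0 => t; rewrite hornerM !horner_on_line PQ0.
have lineE S : S.@[v] = (on_line z w S).[1].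
  by rewrite horner_on_line; apply: meval_eq => i; rewrite mul1r addrC subrK.
have line0 : Q.@[z] = (on_line z w Q).[0].
  by rewrite horner_on_line; apply: meval_eq => i; rewrite mul0r addr0.
rewrite mulf_eq0 => /orP[]/eqP P0; first by rewrite lineE P0 horner0.
by move: Qz; rewrite line0 P0 horner0 eqxx.
Qed.

Lemma on_line_const z w P t :
  (on_line z w P)^`() = 0 -> P.@[fun i => z i + t * w i] = P.@[z].
Proof.
move=> dP; rewrite -horner_on_line.
suff /(congr1 (fun f => f.[t])) : on_line z w P - P.@[z]%:P = 0.
  by rewrite hornerD hornerN hornerC horner0 => /eqP; rewrite subr_eq0 => /eqP.
apply: (@poly_lin_ode_eq0 _ _ 1 0); rewrite ?hornerC ?oner_eq0 //.
  rewrite hornerD hornerN hornerC horner_on_line; apply/eqP; rewrite subr_eq0.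
  by apply/eqP/meval_eq => i; rewrite mul0r addr0.
by rewrite mul1r mulr0 derivB derivC subr0.
Qed.

Lemma meval_const_dir P w :
    (forall v, \sum_i w i * P^`M(i).@[v] = 0) ->
  forall z t, P.@[fun i => z i + t * w i] = P.@[z].
Proof.
move=> dP z t; apply: on_line_const; rewrite deriv_on_line.
apply: poly_fun_eq0 => s; rewrite horner_sum.
rewrite -[RHS](dP (fun i => z i + s * w i)).
by apply: eq_bigr => i _; rewrite hornerZ horner_on_line.
Qed.

Lemma meval_const_deriv P c i :
  (forall v, P.@[v] = c) -> forall v, P^`M(i).@[v] = 0.
Proof.
move=> Pc v; pose w j : R := (j == i)%:R.
have : (on_line v w P)^`() = 0.
  suff -> : on_line v w P = c%:P by rewrite derivC.
  apply/eqP; rewrite -subr_eq0; apply/eqP/poly_fun_eq0 => t.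
  by rewrite hornerD hornerN hornerC horner_on_line Pc subrr.
move/(congr1 (fun f => f.[0])); rewrite deriv_on_line horner_sum horner0.
rewrite (bigD1 i) //= big1 => [|j /negPf ji]; last first.
  by rewrite /w ji scale0r horner0.
rewrite addr0 /w eqxx scale1r horner_on_line => <-.
by apply: meval_eq => j; rewrite mul0r addr0.
Qed.

End Lines.

(** * Plane maps with nilpotent Jacobian matrix *)

Lemma sum_I2 (V : nmodType) (F : 'I_2 -> V) : \sum_i F i = F 0 + F 1.
Proof.
by rewrite !big_ord_recl big_ord0 addr0; congr (_ + F _); apply/val_inj.
Qed.

Lemma fin_I2 (i : 'I_2) : i = 0 \/ i = 1.
Proof. by case: i => [[|[|//]] ?]; [left|right]; apply/val_inj. Qed.

Section NilpotentPlane.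
Variable R : realFieldType.
Variables P Q : {mpoly R[2]}.
Implicit Types z w : 'I_2 -> R.

Hypothesis trace0 : P^`M(0) + Q^`M(1) = 0.
Hypothesis det0 : P^`M(0) * Q^`M(1) - P^`M(1) * Q^`M(0) = 0.

Let Px z := P^`M(0).@[z].
Let Py z := P^`M(1).@[z].
Let Qx z := Q^`M(0).@[z].
Let Qy z := Q^`M(1).@[z].

Let Qy_Px z : Qy z = - Px z.
Proof.
by apply/eqP; rewrite -addr_eq0 addrC -mevalD trace0 meval0.
Qed.

Let nilpotent z : Px z ^+ 2 + Py z * Qx z = 0.
Proof.
have := congr1 (meval z) det0; rewrite mevalB !mevalM meval0.
rewrite -/(Px z) -/(Py z) -/(Qx z) -/(Qy z) Qy_Px => det0z.
by apply: oppr_inj; rewrite oppr0 -[RHS]det0z; ring.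
Qed.

(** The level curves of [P] have zero curvature. Differentiate [det0]
    with respect to the second variable; symmetry of the second derivatives
    and [trace0] eliminate [Q]. *)
Lemma level_curvature0 :
  P^`M(1) ^+ 2 * P^`M(0)^`M(0) - P^`M(0) * P^`M(1) * P^`M(0)^`M(1) *+ 2
    + P^`M(0) ^+ 2 * P^`M(1)^`M(1) = 0.
Proof.
have QyE : Q^`M(1) = - P^`M(0) by apply/eqP; rewrite -addr_eq0 addrC trace0.
have QxyE : Q^`M(0)^`M(1) = - P^`M(0)^`M(0) by rewrite mderiv_comm QyE mderivN.
have := congr1 (mderiv 1) det0.
rewrite QyE mderivB !mderivM QxyE mderivN mderiv0 => dy.
have := congr1 ( *%R P^`M(1)^`M(1)) det0; rewrite QyE mulr0 => detE.
have := congr1 ( *%R P^`M(1)) dy; rewrite mulr0 => dyE.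
by rewrite -[RHS](subrr 0) -{1}dyE -detE; ring.
Qed.

Definition pt (x y : R) : 'I_2 -> R := fun i => if i == 0 then x else y.

(** Zero curvature makes the level curve of [P] through [z] a straight line.
    The derivative [f] of [P] along the tangent at [z] vanishes at [z] and
    satisfies a linear equation [u * f^`() = f * s] by [level_curvature0],
    where the leading coefficient [u] is the squared length of the gradient. *)
Lemma level_line z t :
  P.@[fun i => z i + t * pt (Py z) (- Px z) i] = P.@[z].
Proof.
have [/eqP grad0|grad_n0] := eqVneq (Px z ^+ 2 + Py z ^+ 2) 0.
  have [Pxz Pyz] : Px z = 0 /\ Py z = 0 by split; nra.
  by apply: meval_eq => i; rewrite /pt Pxz Pyz oppr0 if_same mulr0 addr0.
set w := pt _ _; pose L := on_line z w.
pose A := L P^`M(0); pose B := L P^`M(1).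
pose Dxx := L P^`M(0)^`M(0); pose Dxy := L P^`M(0)^`M(1).
pose Dyy := L P^`M(1)^`M(1).
pose A0 := (Px z)%:P; pose B0 := (Py z)%:P.
have derivL S : (L S)^`() = B0 * L S^`M(0) - A0 * L S^`M(1).
  by rewrite deriv_on_line sum_I2 /w /pt /= -!mul_polyC polyCN mulNr.
have L_at0 S : (L S).[0] = S.@[z].
  by rewrite horner_on_line; apply: meval_eq => i; rewrite mul0r addr0.
have curv : B ^+ 2 * Dxx - 2 * A * B * Dxy + A ^+ 2 * Dyy = 0.
  have := congr1 L level_curvature0.
  rewrite /L {1}/on_line mmapD mmapB mmapMn -!/(on_line _ _ _).
  rewrite !on_lineM /on_line mmap0 => <-.
  by rewrite /A /B /Dxx /Dxy /Dyy /L; ring.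
pose f := (L P)^`().
have fE : f = B0 * A - A0 * B by exact: derivL.
have f0 : f = 0.
  (* As [B0 * A - A0 * B = f], the tangents [(B0, - A0)] at [z] and [(B, - A)]
     at the running point are proportional modulo [f]. Replacing the former by
     the latter turns [f^`()], up to a factor, into the expression of
     [level_curvature0]; [B ^+ 2] and [A ^+ 2] allow the replacement. *)
  apply: (@poly_lin_ode_eq0 _ f (A ^+ 2 + B ^+ 2)
    (2 * B0 * B * Dxy + f * Dyy - 2 * B0 * A * Dyy
     + f * Dxx + 2 * A0 * B * Dxx - 2 * A0 * A * Dxy)).
  - by rewrite fE !hornerE !L_at0 -/(Px z) -/(Py z); ring.
  - by rewrite !hornerE !L_at0.
  - have -> : f^`() = B0 ^+ 2 * Dxx - 2 * A0 * B0 * Dxy + A0 ^+ 2 * Dyy.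
      rewrite fE derivB !derivM !derivC !mul0r !add0r !derivL.
      rewrite (mderiv_comm 1 0) -/Dxx -/Dxy -/Dyy; ring.
    have := congr1 ( *%R (A0 ^+ 2 + B0 ^+ 2)) curv; rewrite mulr0 => curvE.
    by rewrite -[RHS]addr0 -curvE fE; ring.
exact: on_line_const.
Qed.

(** If [P] is not constant, take for [w] the tangent to its level line at a
    noncritical point [z1]. A level line with another direction meets the one
    through [z1], so [P] takes the value [P.@[z1]] at every point where [W],
    the determinant of the two directions, is nonzero. If [W] were not
    identically 0, [P] would be constant by [meval_mulI]. The gradient of [Q]
    is parallel to that of [P] at the noncritical points of [P], and
    [meval_mulI] extends the conclusion for [Q] to the other points. If [P] is
    constant, then [Q] depends on the first variable only. *)
Lemma constant_kernel :
  exists w, w 0 ^+ 2 + w 1 ^+ 2 != 0 /\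
    forall z, w 0 * Px z + w 1 * Py z = 0 /\ w 0 * Qx z + w 1 * Qy z = 0.
Proof.
have [[z1 grad_z1]|no_grad] := EM (exists z, Px z ^+ 2 + Py z ^+ 2 != 0);
  last first.
  have grad0 z : Px z = 0 /\ Py z = 0.
    have /eqP grad0 : Px z ^+ 2 + Py z ^+ 2 == 0.
      by apply/negPn/negP => gz; apply: no_grad; exists z.
    by split; nra.
  exists (pt 0 1); rewrite /pt /=; split=> [|z].
    by rewrite expr0n expr1n add0r oner_eq0.
  by rewrite Qy_Px; have [-> ->] := grad0 z; split; ring.
pose W := Py z1 *: P^`M(0) - Px z1 *: P^`M(1).
have WE z : W.@[z] = Py z1 * Px z - Px z1 * Py z by rewrite mevalB !mevalZ.
have W0 z : W.@[z] = 0.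
  have [//|W_n0] := eqVneq W.@[z] 0; exfalso.
  have Pconst v : (P - P.@[z1]%:MP).@[v] = 0.
    apply: (meval_mulI _ W_n0) => {}v.
    have [->|Wv] := eqVneq W.@[v] 0; first by rewrite mulr0.
    (* Cramer's rule gives the parameters of the common point of the two level
       lines, [W] being the determinant of the system. *)
    pose dx := v 0 - z1 0; pose dy := v 1 - z1 1.
    pose s := (dx * Px v + dy * Py v) / W.@[v].
    pose t := (dx * Px z1 + dy * Py z1) / W.@[v].
    suff meet : (fun i => v i + t * pt (Py v) (- Px v) i)
             =1 (fun i => z1 i + s * pt (Py z1) (- Px z1) i).
      rewrite mevalB mevalC -(level_line v t) (meval_eq _ meet) level_line.
      by rewrite subrr mul0r.
    move: Wv; rewrite /s /t WE => Wv.
    move=> i; case: (fin_I2 i) => ->; rewrite /pt /= /dx /dy; field; exact: Wv.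
  have grad0 i : P^`M(i).@[z1] = 0.
    rewrite -(meval_const_deriv i Pconst z1) mderivB mderivC subr0 //.
  by move: grad_z1; rewrite /Px /Py !grad0 expr0n addr0 eqxx.
exists (pt (Py z1) (- Px z1)); rewrite /pt /=.
have kerP z : Py z1 * Px z + - Px z1 * Py z = 0.
  by rewrite -[RHS](W0 z) WE mulNr.
split=> [|z]; first by rewrite sqrrN addrC.
split; first exact: kerP.
pose K := Py z1 *: Q^`M(0) - Px z1 *: Q^`M(1).
have KE v : K.@[v] = Py z1 * Qx v + - Px z1 * Qy v.
  by rewrite mevalB !mevalZ mulNr.
rewrite -KE; have G1 : (P^`M(0) ^+ 2 + P^`M(1) ^+ 2).@[z1] != 0.
  by rewrite mevalD !mevalM.
apply: (meval_mulI _ G1) => {}z; rewrite KE mevalD !mevalM -/(Px z) -/(Py z).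
move: (kerP z) (nilpotent z); rewrite Qy_Px.
move: (Px z) (Py z) (Qx z) => A B C.
move: (Py z1) (- Px z1) => a b ker nil.
have -> : (a * C + b * - A) * (A * A + B * B)
  = (a * A + b * B) * (A * C - A * B) + (a * B - b * A) * (A ^+ 2 + B * C).
  by ring.
by rewrite ker nil mul0r mulr0 addr0.
Qed.

(** The vector [(P, Q)] lies on the line spanned by the direction [w] of
    [constant_kernel], because [w 1 *: P - w 0 *: Q] has zero gradient and
    vanishes at the origin. Moving along that line changes neither [P]
    nor [Q]. *)
Lemma nilpotent_shift z t :
    P.@[fun=> 0] = 0 -> Q.@[fun=> 0] = 0 ->
  P.@[fun i => z i + t * pt P.@[z] Q.@[z] i] = P.@[z] /\
  Q.@[fun i => z i + t * pt P.@[z] Q.@[z] i] = Q.@[z].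
Proof.
move=> P0 Q0; have [w [w_n0 kerPQ]] := constant_kernel.
have colinear : w 1 * P.@[z] = w 0 * Q.@[z].
  apply/eqP; rewrite -subr_eq0 -!mevalZ -mevalB; apply/eqP.
  have /meval_const_dir/(_ (fun=> 0) 1) :
      forall v, \sum_i z i * (w 1 *: P - w 0 *: Q)^`M(i).@[v] = 0.
    move=> v; rewrite sum_I2 !mderivB !mderivZ !mevalB !mevalZ.
    have [kerPv kerQv] := kerPQ v; have := Qy_Px v.
    rewrite -/(Px v) -/(Py v) -/(Qx v) -/(Qy v) => QyE; move: kerPv kerQv.
    rewrite QyE => kerPv kerQv.
    transitivity (z 1 * (w 0 * Px v + w 1 * Py v)
                  - z 0 * (w 0 * Qx v + w 1 * - Px v)); first by ring.
    by rewrite kerPv kerQv !mulr0 subr0.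
  rewrite [RHS]mevalB !mevalZ P0 Q0 !mulr0 subr0 => <-.
  by apply: meval_eq => i; rewrite add0r mul1r.
pose mu := (w 0 * P.@[z] + w 1 * Q.@[z]) / (w 0 ^+ 2 + w 1 ^+ 2).
have shiftE :
    (fun i => z i + t * pt P.@[z] Q.@[z] i) =1 (fun i => z i + t * mu * w i).
  move=> i; rewrite -mulrA; congr (_ + t * _); rewrite /mu mulrAC.
  apply: (canRL (mulfK w_n0)); case: (fin_I2 i) => ->; rewrite /pt /=.
    transitivity (w 0 * (w 0 * P.@[z]) + w 1 * (w 1 * P.@[z])); first by ring.
    by rewrite colinear; ring.
  transitivity (w 0 * (w 0 * Q.@[z]) + w 1 * (w 1 * Q.@[z])); first by ring.
  by rewrite -colinear; ring.
rewrite !(meval_eq _ shiftE).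
by split; apply: meval_const_dir => v; rewrite sum_I2; case: (kerPQ v).
Qed.

End NilpotentPlane.

(** * Degrees of the two parts of the Jacobian determinant *)

Section Supports.
Variables (R : realType) (n : nat).
Implicit Types p q : {mpoly R[n]}.

Lemma mpoly_order_le p m :
  m \in msupp p -> (mpoly_order p <= ((mdeg m)%:Z)%:E)%E.
Proof. by move=> pm; exact: ge_bigmin_seq. Qed.

Lemma mpoly_degree_ge p m :
  m \in msupp p -> (((mdeg m)%:Z)%:E <= mpoly_degree p)%E.
Proof. by move=> pm; exact: le_bigmax_seq. Qed.

Lemma mpoly_order_gt1 p m :
  (1 < mpoly_order p)%E -> m \in msupp p -> (1 < mdeg m)%N.
Proof.
by move=> op /mpoly_order_le/(lt_le_trans op); rewrite lte_fin ltz_nat.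
Qed.

Lemma meval0_order p : (1 < mpoly_order p)%E -> p.@[fun=> 0] = 0.
Proof.
move=> op; rewrite mevalE big_seq big1 // => m /(mpoly_order_gt1 op) m1.
have [i mi] : exists i, m i != 0%N.
  apply/existsP; apply: contraTT m1; rewrite negb_exists => /forallP m0.
  by rewrite mdegE big1 // => i _; have := m0 i; rewrite negbK => /eqP.
by rewrite (bigD1 i) //= expr0n (negPf mi) mul0r mulr0.
Qed.

Lemma msupp_mderiv p i m : m \in msupp p^`M(i) ->
  exists2 m1, m1 \in msupp p & mdeg m1 = (mdeg m).+1.
Proof.
rewrite mcoeff_msupp mcoeff_deriv mulrn_eq0 /= => pm.
by exists (m + U_(i))%MM; rewrite ?mcoeff_msupp // mdegD mdeg1 addn1.
Qed.

Lemma msupp_mderivM p q i j m : m \in msupp (p^`M(i) * q^`M(j)) ->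
  exists m1 m2, [/\ m1 \in msupp p, m2 \in msupp q
                  & (mdeg m1 + mdeg m2 = (mdeg m).+2)%N].
Proof.
move=> /msuppM_le/allpairsP[[m1' m2'] /= [/msupp_mderiv[m1 pm1 d1]]].
move=> /msupp_mderiv[m2 qm2 d2] ->; exists m1, m2; split=> //.
by rewrite mdegD d1 d2 addnS.
Qed.

Lemma gap_condition_sum p q m m1 m2 :
    gap_condition p q -> m1 \in msupp p -> m2 \in msupp q -> m \in msupp q ->
    (1 < mdeg m1)%N ->
  (mdeg m1 + mdeg m2)%N <> (mdeg m).+1.
Proof.
move=> gapPQ pm1 qm2 qm m1_gt1 degE.
apply: (gapPQ m1 (mdeg m1).-1 pm1); first by lia.
exists m, m2; split=> //; last by lia.
(* The gap [mdeg m1 - 1] is positive, so the two monomials differ. *)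
by apply/eqP => mE; move: degE; rewrite mE; lia.
Qed.

(** [mdeg m - 1] is the degree of a monomial of a first derivative of [p] or
    [q], and [mdeg m1 + mdeg m2 - 2] that of a monomial of a product of two
    such derivatives; each of the four alternatives keeps them apart. *)
Lemma degrees_separated p q m m1 m2 :
    (1 < mpoly_order p)%E -> (1 < mpoly_order q)%E ->
    [\/ (maxe (mpoly_degree p) (mpoly_degree q)
           < mpoly_order p + mpoly_order q - 1)%E,
        even_mpoly p /\ even_mpoly q,
        [/\ odd_mpoly p, even_mpoly q & gap_condition p q]
      | symmetric_gap_condition p q] ->
    m \in msupp p \/ m \in msupp q -> m1 \in msupp p -> m2 \in msupp q ->
  (mdeg m1 + mdeg m2)%N <> (mdeg m).+1.
Proof.
move=> op oq cond pqm pm1 qm2 degE.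
have m1_gt1 := mpoly_order_gt1 op pm1; have m2_gt1 := mpoly_order_gt1 oq qm2.
case: cond => [deg_lt | [evp evq] | [odp evq gpq] | [gpq gqp]].
- have : (((mdeg m)%:Z)%:E < ((mdeg m1)%:Z)%:E + ((mdeg m2)%:Z)%:E - 1)%E.
    apply: (@le_lt_trans _ _ (maxe (mpoly_degree p) (mpoly_degree q))).
      rewrite le_max; apply/orP.
      by case: pqm => /mpoly_degree_ge ->; [left|right].
    by apply: (lt_le_trans deg_lt); apply/leeD2r/leeD; apply: mpoly_order_le.
  by rewrite lte_fin; lia.
- have := evp _ pm1; have := evq _ qm2.
  have : ~~ odd (mdeg m) by case: pqm => [/evp|/evq].
  by move: degE => /(congr1 odd); rewrite oddD /=; do 3!case: odd.
- case: pqm => [pm|qm]; last first.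
    exact: (gap_condition_sum gpq pm1 qm2 qm m1_gt1 degE).
  have := odp _ pm1; have := evq _ qm2; have := odp _ pm.
  by move: degE => /(congr1 odd); rewrite oddD /=; do 3!case: odd.
- case: pqm => [pm|qm]; last first.
    exact: (gap_condition_sum gpq pm1 qm2 qm m1_gt1 degE).
  by apply: (gap_condition_sum gqp qm2 pm1 pm m2_gt1); rewrite addnC.
Qed.

End Supports.

Lemma det2 (R : comPzRingType) (A : 'M[R]_2) :
  \det A = A 0 0 * A 1 1 - A 0 1 * A 1 0.
Proof.
rewrite (expand_det_row A 0) sum_I2 /cofactor !det_mx11 !mxE /= !expr0 !expr1.
rewrite mul1r mulN1r mulrN.
congr (A _ _ * A _ _ - A _ _ * A _ _); exact/val_inj.
Qed.

(** The nonconstant part of the determinant is the sum of a linear combination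
    of first derivatives and of the bracket of [p] and [q]. It vanishes, and by
    [degrees_separated] no cancellation can occur between its two parts. *)
Lemma jacobian_split (R : realType) (a b c d : R) (p q : {mpoly R[2]})
    (Phi := [tuple a *: 'X_0 + b *: 'X_1 + p; c *: 'X_0 + d *: 'X_1 + q]
            : 2.-tuple {mpoly R[2]}) :
    (1 < mpoly_order p)%E -> (1 < mpoly_order q)%E ->
    jacobian_map Phi ->
    [\/ (maxe (mpoly_degree p) (mpoly_degree q)
           < mpoly_order p + mpoly_order q - 1)%E,
        even_mpoly p /\ even_mpoly q,
        [/\ odd_mpoly p, even_mpoly q & gap_condition p q]
      | symmetric_gap_condition p q] ->
  [/\ a * d - b * c != 0,
      d *: p^`M(0) - c *: p^`M(1) + (a *: q^`M(1) - b *: q^`M(0)) = 0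
    & p^`M(0) * q^`M(1) - p^`M(1) * q^`M(0) = 0].
Proof.
move=> op oq [k k_n0 detE] cond.
pose L := d *: p^`M(0) - c *: p^`M(1) + (a *: q^`M(1) - b *: q^`M(0)).
pose J := p^`M(0) * q^`M(1) - p^`M(1) * q^`M(0).
rewrite -/L -/J.
have derivE (x y : R) (r : {mpoly R[2]}) :
    ((x *: 'X_0 + y *: 'X_1 + r)^`M(0) = x%:MP + r^`M(0)) *
    ((x *: 'X_0 + y *: 'X_1 + r)^`M(1) = y%:MP + r^`M(1)).
  have Uii (i : 'I_2) : (U_(i) - U_(i) = 0 :> 'X_{1..2})%MM.
    by apply/mnmP => l; rewrite mnmBE subnn mnm0E.
  rewrite !mderivD !mderivZ !mderivX !mnm1E /= !Uii !scale0r !scaler0 !mpolyX0.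
  by rewrite !scale1r !alg_mpolyC addr0 add0r.
have sumE : (a * d - b * c)%:MP + (L + J) = k%:MP.
  rewrite -detE det2 !mxE !(tnth_nth 0) /= !derivE.
  rewrite /L /J -!mul_mpolyC !(mpolyCB, mpolyCM); ring.
have L_supp m : m \in msupp L ->
    exists2 m', m' \in msupp p \/ m' \in msupp q & mdeg m' = (mdeg m).+1.
  rewrite /L => /msuppD_le; rewrite mem_cat => /orP[]/msuppB_le;
    rewrite mem_cat => /orP[]/msuppZ_le/msupp_mderiv[m' rm' dE];
    exists m' => //; by [left | right].
have J_supp m : m \in msupp J ->
    exists m1 m2, [/\ m1 \in msupp p, m2 \in msupp q
                    & (mdeg m1 + mdeg m2 = (mdeg m).+2)%N].
  by move=> /msuppB_le; rewrite mem_cat => /orP[]/msupp_mderivM.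
have L0 : L@_0 = 0.
  apply/eqP; rewrite mcoeff_eq0; apply/negP => /L_supp[m' pqm].
  have : (1 < mdeg m')%N by case: pqm; exact: mpoly_order_gt1.
  by rewrite mdeg0 => /[swap] ->.
have J0 : J@_0 = 0.
  apply/eqP; rewrite mcoeff_eq0; apply/negP => /J_supp[m1 [m2 [pm1 qm2]]].
  have := mpoly_order_gt1 op pm1; have := mpoly_order_gt1 oq qm2.
  by rewrite mdeg0; lia.
have kE : a * d - b * c = k.
  have := congr1 (mcoeff 0%MM) sumE; rewrite mcoeffD [(L + J)@__]mcoeffD.
  by rewrite L0 J0 !mcoeffC eqxx !mulr1 !addr0.
have LJ : L = - J.
  by apply/eqP; rewrite -addr_eq0 -(inj_eq (addrI k%:MP)) addr0 -{1}kE sumE.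
have L_eq0 : L = 0.
  apply/mpolyP => m; rewrite mcoeff0; apply/eqP; rewrite mcoeff_eq0.
  apply/negP => Lm; have [m' pqm dE] := L_supp m Lm.
  move: Lm; rewrite LJ (perm_mem (msuppN J)) => /J_supp[m1 [m2 [pm1 qm2]]].
  by rewrite -dE; exact: (degrees_separated op oq cond pqm pm1 qm2).
split=> //; first by rewrite kE.
by apply: oppr_inj; rewrite -LJ oppr0.
Qed.

(** * Invertibility *)

Theorem theorem1 (R : realType) (a b c d : R) (p q : {mpoly R[2]})
    (Phi := [tuple a *: 'X_0 + b *: 'X_1 + p; c *: 'X_0 + d *: 'X_1 + q]
            : 2.-tuple {mpoly R[2]}) :
  (1 < mpoly_order p)%E ->
  (1 < mpoly_order q)%E ->
  jacobian_map Phi ->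
  [\/ (maxe (mpoly_degree p) (mpoly_degree q)
         < mpoly_order p + mpoly_order q - 1)%E,
      even_mpoly p /\ even_mpoly q,
      [/\ odd_mpoly p, even_mpoly q & gap_condition p q]
    | symmetric_gap_condition p q] ->
  bijective (polymap Phi).
Proof.
move=> op oq jac cond; have [k_n0 L0 J0] := jacobian_split op oq jac cond.
set k := a * d - b * c in k_n0.
(* [(P, Q)] is [(p, q)] composed with the inverse of the linear part. *)
pose P := k^-1 *: (d *: p - b *: q); pose Q := k^-1 *: (a *: q - c *: p).
have trace0 : P^`M(0) + Q^`M(1) = 0.
  rewrite /P /Q !mderivZ !mderivB !mderivZ -scalerDr -[RHS](scaler0 _ k^-1) -L0.
  by rewrite -!mul_mpolyC; ring.
have det0 : P^`M(0) * Q^`M(1) - P^`M(1) * Q^`M(0) = 0.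
  rewrite /P /Q !mderivZ !mderivB !mderivZ.
  rewrite -[RHS](mulr0 ((k^-1)%:MP ^+ 2 * (d%:MP * a%:MP - b%:MP * c%:MP))) -J0.
  by rewrite -!mul_mpolyC; ring.
have P0 : P.@[fun=> 0] = 0.
  by rewrite mevalZ mevalB !mevalZ !meval0_order // !mulr0 subr0 mulr0.
have Q0 : Q.@[fun=> 0] = 0.
  by rewrite mevalZ mevalB !mevalZ !meval0_order // !mulr0 subr0 mulr0.
have shift z t := nilpotent_shift trace0 det0 z t P0 Q0.
have PE z : P.@[z] = k^-1 * (d * p.@[z] - b * q.@[z]).
  by rewrite mevalZ mevalB !mevalZ.
have QE z : Q.@[z] = k^-1 * (a * q.@[z] - c * p.@[z]).
  by rewrite mevalZ mevalB !mevalZ.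
have Phi0 v : polymap Phi v 0 0 = a * v 0 0 + b * v 0 1 + p.@[fun j => v 0 j].
  by rewrite mxE (tnth_nth 0) /= !mevalD !mevalZ !mevalXU.
have Phi1 v : polymap Phi v 0 1 = c * v 0 0 + d * v 0 1 + q.@[fun j => v 0 j].
  by rewrite mxE (tnth_nth 0) /= !mevalD !mevalZ !mevalXU.
pose lin_inv (w : 'rV[R]_2) : 'I_2 -> R :=
  pt (k^-1 * (d * w 0 0 - b * w 0 1)) (k^-1 * (a * w 0 1 - c * w 0 0)).
pose Psi (w : 'rV[R]_2) : 'rV[R]_2 :=
  \row_i (lin_inv w i - pt P.@[lin_inv w] Q.@[lin_inv w] i).
exists Psi => [v|w].
  have linE : lin_inv (polymap Phi v)
      =1 (fun i => v 0 i + 1 * pt P.@[fun j => v 0 j] Q.@[fun j => v 0 j] i).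
    move=> i; rewrite /lin_inv Phi0 Phi1.
    by case: (fin_I2 i) => ->; rewrite /pt /= ?PE ?QE /k; field; exact: k_n0.
  have [Pv Qv] := shift (fun j => v 0 j) 1.
  apply/rowP => i; rewrite mxE linE !(meval_eq _ linE) Pv Qv mul1r.
  by rewrite addrK.
set u := lin_inv w.
have PsiE : (fun j => Psi w 0 j) =1 (fun i => u i + (-1) * pt P.@[u] Q.@[u] i).
  by move=> i; rewrite mxE mulN1r.
have pE z : p.@[z] = a * P.@[z] + b * Q.@[z].
  by rewrite PE QE /k; field; exact: k_n0.
have qE z : q.@[z] = c * P.@[z] + d * Q.@[z].
  by rewrite PE QE /k; field; exact: k_n0.
have [Pu Qu] := shift u (-1).
apply/rowP => i; case: (fin_I2 i) => ->.
  rewrite Phi0 pE !(meval_eq _ PsiE) Pu Qu !PsiE /pt /= /u /lin_inv /pt /= /k.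
  by field; exact: k_n0.
rewrite Phi1 qE !(meval_eq _ PsiE) Pu Qu !PsiE /pt /= /u /lin_inv /pt /= /k.
by field; exact: k_n0.
Qed.
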